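(* Let $A=A_s+\epsilon A_i$ be an $n\times n$ symmetric positive definite dual real matrix. Suppose $A_s=L_sL_s^\top$ is the Cholesky decomposition of $A_s$ ($L_s\in\mathbb{R}^{n\times n}$ lower triangular), and $A_s$ is invertible. Then the Cholesky decomposition $A=LL^\top$ of the dual matrix exists, where $L=L_s+\epsilon L_i$ is an $n\times n$ lower triangular dual real matrix. Additionally, the infinitesimal part $L_i$ of $L$ is $$L_i=\tfrac12A_i(L_s^\top)^{-1}-L_sP,$$ where $P\in\mathbb{R}^{n\times n}$ is the skew-symmetric matrix whose strictly upper triangular part is given by $$P(1:t-1,\,t)=L_s^{-1}(1:t-1,\,1:t-1)\,B(1:t-1,\,t),\qquad t=2,3,\dots,n,$$ with $B=\tfrac12A_i(L_s^\top)^{-1}\in\mathbb{R}^{n\times n}$.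
   Context: A dual real matrix is a formal expression $A=A_s+\epsilon A_i$ with real matrices $A_s$ (standard part) and $A_i$ (infinitesimal part), where $\epsilon^2=0$ and $\epsilon$ commutes with everything; thus $(A_s+\epsilon A_i)(B_s+\epsilon B_i)=A_sB_s+\epsilon(A_sB_i+A_iB_s)$, and $A^\top=A_s^\top+\epsilon A_i^\top$. A dual real matrix $A=A_s+\epsilon A_i$ is symmetric positive definite iff $A_s$ is symmetric positive definite and $A_i$ is symmetric. A dual matrix is lower triangular if both its standard and infinitesimal parts are. MATLAB notation is used: $M(a:b,c:d)$ is the submatrix of $M$ with rows $a,\dots,b$ and columns $c,\dots,d$, and $M(a:b,c)$ is the corresponding segment of column $c$; $L_s^{-1}(1:t-1,1:t-1)$ is the leading $(t-1)\times(t-1)$ submatrix of $L_s^{-1}$ (equivalently, since $L_s$ is lower triangular, the inverse of the leading submatrix of $L_s$). *)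

(* Defs.v *)
From HB Require Import structures.
From mathcomp Require Import all_boot all_order all_algebra.
From mathcomp Require Import reals.

Set Implicit Arguments.
Unset Strict Implicit.
Unset Printing Implicit Defensive.

Import Order.TTheory GRing.Theory Num.Theory.
Local Open Scope ring_scope.

(* [DualMx As Ai] stands for the formal expression As + eps Ai, eps ^ 2 = 0. *)
Record dualmx (R : realType) (m n : nat) := DualMx {
  std_part : 'M[R]_(m, n);
  inf_part : 'M[R]_(m, n)
}.

Definition dualmx_mul (R : realType) (m n p : nat)
    (A : dualmx R m n) (B : dualmx R n p) : dualmx R m p :=
  DualMx (std_part A *m std_part B)
         (std_part A *m inf_part B + inf_part A *m std_part B).

Definition dualmx_tr (R : realType) (m n : nat) (A : dualmx R m n) :
    dualmx R n m :=
  DualMx (std_part A)^T (inf_part A)^T.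

Definition symmetric_mx (R : realType) (n : nat) (M : 'M[R]_n) : Prop :=
  M^T = M.

Definition skew_symmetric_mx (R : realType) (n : nat) (M : 'M[R]_n) : Prop :=
  M^T = - M.

Definition sym_posdef (R : realType) (n : nat) (M : 'M[R]_n) : Prop :=
  symmetric_mx M /\
  forall x : 'cV[R]_n, x != 0 -> 0 < (x^T *m M *m x) 0 0.

Definition dual_sym_posdef (R : realType) (n : nat) (A : dualmx R n n) : Prop :=
  sym_posdef (std_part A) /\ symmetric_mx (inf_part A).

(* [is_trig_mx] is lower triangularity: M i j = 0 whenever i < j. *)
Definition dual_lower_trig (R : realType) (m n : nat) (A : dualmx R m n) : Prop :=
  is_trig_mx (std_part A) /\ is_trig_mx (inf_part A).

(* The factor is not required to have a positive diagonal. *)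
Definition is_cholesky (R : realType) (n : nat) (M L : 'M[R]_n) : Prop :=
  is_trig_mx L /\ M = L *m L^T.

Definition is_dual_cholesky (R : realType) (n : nat) (A L : dualmx R n n) : Prop :=
  dual_lower_trig L /\ A = dualmx_mul L (dualmx_tr L).

(* With t : 'I_n counted from 0, the indices strictly before t are those
   written 1:t-1 when the columns are numbered from 1. *)
Definition before (n : nat) (t : 'I_n) : 'I_t -> 'I_n :=
  widen_ord (ltnW (ltn_ord t)).
Arguments before {n} t _.

(* M(1:t-1, 1:t-1) *)
Definition lead_submx (R : realType) (n : nat) (t : 'I_n) (M : 'M[R]_n) :
    'M[R]_t :=
  mxsub (before t) (before t) M.

(* M(1:t-1, t) *)
Definition col_above (R : realType) (n : nat) (t : 'I_n) (M : 'M[R]_n) :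
    'cV[R]_t :=
  rowsub (before t) (col t M).

(* Main.v *)
(** Writing Ls^-1 Li = X, the infinitesimal part of A = L L^T becomes
    X + X^T = S with S = Ls^-1 Ai Ls^-T symmetric.  A lower triangular X
    solves this iff X = S/2 - P, where P is the skew-symmetric matrix with the
    strictly upper part of S/2; and S/2 = Ls^-1 B. *)
Require Import Defs.
From HB Require Import structures.
From mathcomp Require Import all_boot all_order all_algebra.
From mathcomp Require Import reals.

Set Implicit Arguments.
Unset Strict Implicit.
Unset Printing Implicit Defensive.

Import Order.TTheory GRing.Theory Num.Theory.
Local Open Scope ring_scope.

Lemma mulmx_is_trig (R : pzSemiRingType) (m n p : nat) (M : 'M[R]_(m, n))
    (N : 'M[R]_(n, p)) :
  is_trig_mx M -> is_trig_mx N -> is_trig_mx (M *m N).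
Proof.
move=> /is_trig_mxP tM /is_trig_mxP tN; apply/is_trig_mxP => i j ij.
rewrite mxE big1 // => k _; case: (ltnP i k) => [ik | ki].
  by rewrite tM // mul0r.
by rewrite tN ?mulr0 // (leq_ltn_trans ki).
Qed.

(** Strong induction on the row [i]. In the vanishing entry [(i, j)] of [M *m invmx M], terms with
    [l > i] die by triangularity of [M] and those with [l < i] by induction. What is left is [M i i]
    times the entry sought, and [M i i] is nonzero because the determinant is the product of the
    diagonal. *)
Lemma invmx_is_trig (F : fieldType) (n : nat) (M : 'M[F]_n) :
  M \in unitmx -> is_trig_mx M -> is_trig_mx (invmx M).
Proof.
move=> uM tM; have /is_trig_mxP tM' := tM.
have diag_neq0 i : M i i != 0.
  by move: uM; rewrite unitmxE det_trig // unitfE => /prodf_neq0; apply.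
apply/is_trig_mxP => i; have [k] := ubnP (i : nat).
elim: k i => // k IHk i ik j ij.
have /matrixP/(_ i j) := mulmxV uM.
rewrite !mxE (bigD1 i) //= big1 => [|l li]; last first.
  have [il | li'] := ltnP i l; first by rewrite tM' // mul0r.
  have lti : (l < i)%N by rewrite ltn_neqAle li' andbT -val_eqE in li *.
  by rewrite (IHk l (leq_trans lti ik) j (ltn_trans lti ij)) mulr0.
rewrite addr0 (_ : (i == j) = false); last by apply/negbTE; rewrite -val_eqE ltn_eqF.
by move/eqP; rewrite mulf_eq0 (negbTE (diag_neq0 i)) => /eqP.
Qed.

(** Rows of [M] before [t] vanish from column [t] on, so each sum stops before [t]. *)
Lemma col_above_mulmx (R : realType) (n : nat) (t : 'I_n) (M N : 'M[R]_n) :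
  is_trig_mx M ->
  col_above t (M *m N) = lead_submx t M *m col_above t N.
Proof.
move=> /is_trig_mxP tM; apply/matrixP => i j; rewrite !mxE.
under [RHS]eq_bigr do rewrite !mxE.
rewrite (bigID (fun k : 'I_n => (k < t)%N)) /= [X in _ + X]big1 ?addr0.
  by rewrite (big_ord_narrow (ltnW (ltn_ord t))).
by move=> k; rewrite -leqNgt => tk; rewrite tM ?mul0r // (leq_trans _ tk) /=.
Qed.

Definition skew_upper (R : pzRingType) (n : nat) (M : 'M[R]_n) : 'M[R]_n :=
  \matrix_(i, j) (if (i < j)%N then M i j
                  else if (j < i)%N then - M j i else 0).

Lemma skew_upper_skew (R : realType) (n : nat) (M : 'M[R]_n) :
  skew_symmetric_mx (skew_upper M).
Proof.
by apply/matrixP => i j; rewrite !mxE; case: ltngtP => _; rewrite ?opprK ?oppr0.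
Qed.

Lemma sub_skew_upper_is_trig (R : pzRingType) (n : nat) (M : 'M[R]_n) :
  is_trig_mx (M - skew_upper M).
Proof. by apply/is_trig_mxP => i j ij; rewrite !mxE ij subrr. Qed.

(** Uniqueness of the triangular solution: off the diagonal one of [X i j], [X j i] is zero, so the
    equation gives the other; on the diagonal it reads [2 X i i = 2 H i i], and 2 can be
    cancelled. *)
Lemma trig_add_tr_eq (F : numFieldType) (n : nat) (X H : 'M[F]_n) :
  is_trig_mx X -> H^T = H -> X + X^T = H + H -> X = H - skew_upper H.
Proof.
move=> /is_trig_mxP tX /matrixP sH /matrixP eXH; apply/matrixP => i j.
have := eXH i j; have := sH i j; rewrite !mxE => Hji.
case: ltngtP => [ij | ji | /val_inj ->].
- by rewrite tX // subrr.
- by rewrite (tX j i) // addr0 Hji opprK.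
- rewrite subr0 -!mulr2n => /eqP; rewrite -subr_eq0 -mulrnBl mulrn_eq0 /=.
  by rewrite subr_eq0 => /eqP.
Qed.

Theorem theorem4p3 (R : realType) (n : nat) (A : dualmx R n n) (Ls : 'M[R]_n)
  (hA : dual_sym_posdef A)
  (hLs : is_cholesky (std_part A) Ls)
  (hAs : std_part A \in unitmx) :
  let B : 'M[R]_n := 2^-1 *: (inf_part A *m invmx Ls^T) in
  (exists L : dualmx R n n, is_dual_cholesky A L /\ std_part L = Ls) /\
  (exists P : 'M[R]_n,
    [/\ skew_symmetric_mx P,
        forall t : 'I_n, (0 < t)%N ->
          col_above t P = lead_submx t (invmx Ls) *m col_above t B
      & forall L : dualmx R n n, is_dual_cholesky A L -> std_part L = Ls ->
          inf_part L = B - Ls *m P]).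
Proof.
case: A hA hLs hAs => As Ai [_ sAi] [tLs eAs] uAs B.
rewrite /symmetric_mx /= in sAi eAs uAs; simpl in B |- *.
have uLs : Ls \in unitmx by move: uAs; rewrite eAs unitmx_mul => /andP[].
have uLsT : Ls^T \in unitmx by rewrite unitmx_tr.
have tK := invmx_is_trig uLs tLs.
pose H := invmx Ls *m B; pose P := skew_upper H.
have HE : H + H = invmx Ls *m Ai *m invmx Ls^T.
  rewrite /H /B -scalemxAr -scalerDl mulmxA -mulr2n -[_ *+ 2]mulr_natr.
  by rewrite mulVf ?pnatr_eq0 // scale1r.
have sH : H^T = H.
  rewrite /H /B -scalemxAr linearZ /= !trmx_mul !trmx_inv trmxK sAi.
  by rewrite mulmxA.
have eX : (H - P) + (H - P)^T = H + H.
  by rewrite linearB /= sH skew_upper_skew opprK addrACA addNr addr0.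
split.
  (* With [X = H - P], the infinitesimal part of the product is [Ls (X^T + X) Ls^T], which [eX] and
     [HE] turn into [Ai]. *)
  exists (DualMx Ls (Ls *m (H - P))); split=> //; split.
    by split=> //=; apply: mulmx_is_trig (sub_skew_upper_is_trig _).
  rewrite /dualmx_mul /= -eAs; congr DualMx.
  rewrite trmx_mul mulmxA -mulmxDl -mulmxDr addrC eX HE !mulmxA.
  by rewrite mulmxV // mul1mx mulmxKV.
exists P; split; first exact: skew_upper_skew.
  (* As [invmx Ls] is lower triangular, the right-hand side is the part of column [t] of [H] above
     the diagonal, where [P] agrees with [H]. *)
  move=> t _; rewrite -col_above_mulmx //; apply/matrixP => i j.
  by rewrite !mxE /= ltn_ord.
move=> [Ls' Li] /= [[/= _ tLi] [_ eAi]] eLs; rewrite {}eLs /= in eAi *.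
(* Conjugating [Ai = Ls Li^T + Li Ls^T] by [Ls^-1] shows that [X = Ls^-1 Li] solves
   [X + X^T = H + H]. *)
have := @trig_add_tr_eq _ _ (invmx Ls *m Li) H (mulmx_is_trig tK tLi) sH.
rewrite HE -/P eAi trmx_mul trmx_inv mulmxDr mulmxDl !mulmxA mulVmx // mul1mx.
rewrite addrC mulmxK // => /(_ erefl) eLi.
(* Multiplying back by [Ls] gives the formula, since [Ls H = B]. *)
by rewrite -[LHS](mulKVmx uLs) eLi mulmxBr mulKVmx.
Qed.
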